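(* Let $\mathfrak a\in\mathfrak{Ab}$. Then $\mathfrak z_{\mathfrak g}(\mathfrak a)\subset\mathfrak u$ if and only if $\mathfrak a$ is of full rank.
   Context: Let $\mathfrak g$ be a complex simple Lie algebra of rank $n$ with triangular decomposition $\mathfrak g=\mathfrak u\oplus\mathfrak t\oplus\mathfrak u^-$, Cartan subalgebra $\mathfrak t$, Borel subalgebra $\mathfrak b=\mathfrak u\oplus\mathfrak t$, and positive roots $\Delta^+$ corresponding to $\mathfrak u$. $\mathfrak{Ab}$ is the set of abelian ideals of $\mathfrak b$, i.e., subspaces $\mathfrak a\subset\mathfrak u$ with $[\mathfrak b,\mathfrak a]\subset\mathfrak a$ and $[\mathfrak a,\mathfrak a]=0$. Each $\mathfrak a\in\mathfrak{Ab}$ is a sum of root spaces, $\mathfrak a=\bigoplus_{\gamma\in I_{\mathfrak a}}\mathfrak g_\gamma$ with $I_{\mathfrak a}\subset\Delta^+$. The ideal $\mathfrak a$ is of full rank if $I_{\mathfrak a}$ contains $n$ linearly independent roots. $\mathfrak z_{\mathfrak g}(\mathfrak a)$ denotes the centraliser of $\mathfrak a$ in $\mathfrak g$. *)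

(* Defs.v *)
From HB Require Import structures.
From mathcomp Require Import all_boot all_order all_algebra.
From mathcomp Require Export complex.
From mathcomp Require Export reals.

Set Implicit Arguments.
Unset Strict Implicit.
Unset Printing Implicit Defensive.

Import GRing.Theory.
Local Open Scope ring_scope.

HB.mixin Record hasLieBracket (K : fieldType) L of Vector K L := {
  lie : L -> L -> L;
  lie_linearl : forall y, linear (fun x => lie x y);
  lie_linearr : forall x, linear (lie x);
  liexx : forall x, lie x x = 0;
  lie_jacobi : forall x y z,
    lie x (lie y z) + lie y (lie z x) + lie z (lie x y) = 0
}.

#[short(type="lieAlgType")]
HB.structure Definition LieAlgebra (K : fieldType) :=
  { L of Vector K L & hasLieBracket K L }.

Arguments lie {K s} x y : simpl never.

Section Lie.
Variables (K : fieldType) (g : lieAlgType K).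
Implicit Types (x y : g) (U V W a t : {vspace g}).

HB.instance Definition _ x :=
  GRing.isLinear.Build K g g *:%R (lie x) (lie_linearr x).

Definition ad x : 'End(g) := linfun (lie x).

Lemma adE x y : ad x y = lie x y. Proof. exact: lfunE. Qed.

Lemma lieDl x y z : lie (x + y) z = lie x z + lie y z.
Proof. by have := lie_linearl z 1 x y; rewrite !scale1r. Qed.

Lemma lie0l y : lie 0 y = 0.
Proof. by apply: (addIr (lie 0 y)); rewrite -lieDl !add0r. Qed.

Lemma lieZl c x y : lie (c *: x) y = c *: lie x y.
Proof. by have := lie_linearl y c x 0; rewrite !addr0 lie0l addr0. Qed.

Lemma lieC x y : lie x y = - lie y x.
Proof.
have h : lie (x + y) (x + y) = 0 by rewrite liexx.
apply/eqP; rewrite -addr_eq0 -[X in _ == X]h lieDl !linearD /=.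
by rewrite !liexx add0r addr0.
Qed.

(* [U, V] is contained in W. *)
Definition lie_sub U V W : Prop :=
  forall x y, x \in U -> y \in V -> lie x y \in W.

Definition simple_lie : Prop :=
  (exists x y, lie x y != 0) /\
  (forall U, lie_sub fullv U U -> U = 0%VS \/ U = fullv).

Definition diagonalizable_end (f : 'End(g)) : Prop :=
  exists2 e : seq g, basis_of fullv e &
    forall v, v \in e -> exists c : K, f v = c *: v.

(* Cartan subalgebras of a semisimple Lie algebra over an algebraically
   closed field of characteristic zero: maximal commutative subalgebras
   consisting of ad-diagonalizable elements (e.g. B. C. Hall, Lie Groups,
   Lie Algebras, and Representations, Def. 7.10). *)
Definition cartan t : Prop :=
  [/\ lie_sub t t 0%VS,
      forall x, (forall h, h \in t -> lie h x = 0) -> x \in t &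
      forall h, h \in t -> diagonalizable_end (ad h)].

Definition centraliser a : {vspace g} :=
  (\bigcap_(y <- vbasis a) lker (ad y))%VS.

Lemma centraliserP a x :
  x \in centraliser a <-> (forall y, y \in a -> lie x y = 0).
Proof.
have inC (s : seq g) : (x \in (\bigcap_(y <- s) lker (ad y))%VS) =
    all (fun y => lie y x == 0) s.
  elim: s => [|y s IH]; first by rewrite big_nil memvf.
  by rewrite big_cons memv_cap IH memv_ker adE.
rewrite /centraliser inC; split=> [/allP h y ya|h].
  rewrite (coord_vbasis ya) linear_sum /= big1 // => i _.
  rewrite linearZ /= lieC (eqP (h _ _)) ?oppr0 ?scaler0 //.
  by rewrite mem_nth ?size_tuple.
by apply/allP=> y /vbasis_mem ya; rewrite lieC h ?oppr0.
Qed.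

Section Roots.
Variable t : {vspace g}.

(* The dual space of t. *)
Definition dual : vectType K := 'Hom(subvs_of t, K^o).

(* The subspace of all x with [h, x] = alpha(h) x for every h in t; the
   condition is tested on a basis of t, see root_spaceP. *)
Definition root_space (alpha : dual) : {vspace g} :=
  (\bigcap_(h <- vbasis {: subvs_of t})
     passmx.leigenspace (ad (vsval h)) (alpha h))%VS.

Lemma root_spaceP (alpha : dual) x :
  x \in root_space alpha <->
  (forall h : subvs_of t, lie (vsval h) x = (alpha h : K) *: x).
Proof.
have inC (s : seq (subvs_of t)) :
    (x \in (\bigcap_(h <- s) passmx.leigenspace (ad (vsval h)) (alpha h))%VS) =
    all (fun h => lie (vsval h) x == (alpha h : K) *: x) s.
  elim: s => [|y s IH]; first by rewrite big_nil memvf.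
  rewrite big_cons memv_cap IH memv_ker /= add_lfunE opp_lfunE scale_lfunE.
  by rewrite id_lfunE adE subr_eq0.
rewrite /root_space inC; split=> [/allP H h|H]; last first.
  by apply/allP=> h _; rewrite H.
rewrite (coord_vbasis (memvf h)).
apply: (big_ind (fun h => lie (vsval h) x = (alpha h : K) *: x)).
- by rewrite !linear0 scale0r lie0l.
- by move=> p q Hp Hq; rewrite !linearD /= lieDl Hp Hq scalerDl.
move=> i _; set v := _`_i.
have /eqP Hv : lie (vsval v) x == (alpha v : K) *: x.
  by apply: H; rewrite mem_nth ?size_tuple.
by rewrite !linearZ /= lieZl Hv scalerA.
Qed.

Definition is_root (alpha : dual) : Prop :=
  alpha != 0 /\ root_space alpha != 0%VS.

Definition nat_comb (Pi : (\dim t).-tuple dual) (alpha : dual) : Prop :=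
  exists c : 'I_(\dim t) -> nat, alpha = \sum_i tnth Pi i *+ c i.

Definition simple_roots (Pi : (\dim t).-tuple dual) : Prop :=
  [/\ basis_of fullv Pi,
      forall alpha, alpha \in Pi -> is_root alpha &
      forall alpha, is_root alpha -> nat_comb Pi alpha \/ nat_comb Pi (- alpha)].

(* Dp enumerates, without repetition, a system of positive roots. *)
Definition positive_roots (Dp : seq dual) : Prop :=
  uniq Dp /\
  exists2 Pi : (\dim t).-tuple dual, simple_roots Pi &
    forall alpha, alpha \in Dp <-> is_root alpha /\ nat_comb Pi alpha.

Variable Dp : seq dual.

(* The subalgebras u and b = u + t. *)
Definition nilradical : {vspace g} := (\sum_(gamma <- Dp) root_space gamma)%VS.

Definition borel : {vspace g} := (nilradical + t)%VS.

Definition abelian_ideal a : Prop :=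
  [/\ (a <= nilradical)%VS, lie_sub borel a a & lie_sub a a 0%VS].

(* The set of gamma in Dp with g_gamma contained in a. *)
Definition ideal_roots a : seq dual :=
  [seq gamma <- Dp | (root_space gamma <= a)%VS].

Definition full_rank a : Prop :=
  exists s : seq dual,
    [/\ {subset s <= ideal_roots a}, size s = \dim t & free s].

End Roots.
End Lie.

(* Main.v *)
Require Import Defs.
From HB Require Import structures.
From mathcomp Require Import all_boot all_order all_algebra.
From mathcomp Require Import boolp complex reals.

(** An abelian ideal a and its centraliser z are stable under b, so each is the
sum of its intersections with t and with the root spaces.

If a has full rank, an element of z in t is killed by enough roots to vanish.
A nonzero x of z in a negative root space g_-gamma would, after bracketing with
a suitable element of g_gamma, give a nonzero element of z in t
([root_pairing]); hence only positive root spaces meet z.  Conversely, if the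
roots of a do not span the dual of t, some nonzero h in t is killed by all of
them.  This h centralises a, because a is the sum of the root spaces that it
contains; that last fact needs every root space to be a line
([root_space_dim1]).  But h is not in u.

So the work lies in two facts of the structure theory, derived here from the
joint diagonalisation of t ([weight_basis]).  Let e be a basis of g made of
weight vectors.

- Pairing.  Evaluated at the point h0 of t where all simple roots are 1, every
  root is a nonzero integer, so the trace of (ad h0)^2 is positive and the
  Killing form is not zero.  Its radical is an ideal, so simplicity makes it
  nondegenerate ([killing_nondegenerate]).  Invariance then pairs g_gamma with
  g_-gamma.

- Dimension one.  Take x in g_gamma and y in g_-gamma with h = [x, y] nonzero.
  On any subspace stable under ad x and ad y, ad h is a commutator and has
  trace 0 ([weight_sum0]).  On the gamma-string through a root beta this says
  that gamma(h) = 0 would force beta(h) = 0; all roots would vanish at h, so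
  gamma(h) is not 0 ([root_neq0_at_bracket]).  On the span of y, of t and of
  all g_(k gamma) with k > 0, it says that -1 + sum of k dim g_(k gamma) is 0,
  so g_gamma has dimension 1.

All subspaces whose traces are used are spanned by parts of e, so a trace
relative to an explicit free family is enough. *)

Set Implicit Arguments.
Unset Strict Implicit.
Unset Printing Implicit Defensive.

Import Order.TTheory GRing.Theory Num.Theory.
Local Open Scope ring_scope.

(** * Eigenvector decompositions *)

Lemma span_free_subseq (K : fieldType) (V : vectType K) (s : seq V) :
  exists s', [/\ {subset s' <= s}, free s' & (<<s'>> = <<s>>)%VS].
Proof.
elim: s => [|x s [s' [sub fr eqs]]]; first by exists [::]; rewrite nil_free.
have [xs|xs] := boolP (x \in <<s>>%VS).
  exists s'; split=> // [y /sub ys|]; first by rewrite inE ys orbT.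
  rewrite eqs span_cons; symmetry; apply/addv_idPr.
  by rewrite -memvE.
exists (x :: s'); split; last by rewrite !span_cons eqs.
  by move=> y; rewrite !inE => /orP[->//|/sub ->]; rewrite orbT.
by rewrite free_cons eqs xs.
Qed.

Lemma sum_by_value (T A : eqType) (V : nmodType) (c : T -> A) (e : seq T)
    (F : T -> V) :
  \sum_(v <- e) F v =
  \sum_(a <- undup (map c e)) \sum_(v <- e | c v == a) F v.
Proof.
under [RHS]eq_bigr => a _ do rewrite big_mkcond.
rewrite exchange_big /= big_seq [RHS]big_seq; apply: eq_bigr => v ve.
rewrite (bigD1_seq (c v)) ?undup_uniq ?mem_undup ?map_f //= eqxx.
by rewrite big1 ?addr0 // => a; rewrite eq_sym => /negPf ->.
Qed.

(** Applying f h - chi i0 h to the sum removes the term of index i0 and multiplies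
each other one by a scalar that is nonzero for some h, so induction on the
number of terms applies.  With W = 0 this is the independence of eigenspaces;
it serves both for a single operator and for the weights of t. *)
Lemma stable_components (K : fieldType) (V : vectType K) (W : {vspace V})
    (I : eqType) (H : Type) (f : H -> 'End(V)) (chi : I -> H -> K)
    (C : seq I) (v : I -> V) :
  (forall h w, w \in W -> f h w \in W) ->
  (forall i j, i != j -> exists h, chi i h != chi j h) ->
  uniq C -> (forall i h, i \in C -> f h (v i) = chi i h *: v i) ->
  \sum_(i <- C) v i \in W -> forall i, i \in C -> v i \in W.
Proof.
move=> stab sep; elim: C v => [|i0 C IH] v //= /andP[i0C uC] eig.
rewrite big_cons => sumW.
have tailW i : i \in C -> v i \in W.
  move=> iC; have ne : i != i0 by apply: contraNneq i0C => <-.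
  have [h neh] := sep _ _ ne.
  have /IH : \sum_(j <- C) (chi j h - chi i0 h) *: v j \in W.
    have := memvB (stab h _ sumW) (memvZ (chi i0 h) sumW).
    rewrite linearD /= eig ?mem_head // scalerDr opprD addrACA subrr add0r.
    rewrite linear_sum scaler_sumr /= -sumrB.
    congr (_ \in W); apply: eq_big_seq => j jC.
    by rewrite eig ?inE ?jC ?orbT // scalerBl.
  move=> /(_ uC) IH'.
  have {IH'} : (chi i h - chi i0 h) *: v i \in W.
    apply: IH' => // j h' jC.
    by rewrite linearZ /= eig ?inE ?jC ?orbT // !scalerA mulrC.
  by rewrite rpredZeq subr_eq0 (negPf neh).
move=> i; rewrite inE => /orP[/eqP->|/tailW//].
have : \sum_(j <- C) v j \in W by rewrite big_seq; apply: memv_suml.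
by move=> /(memvB sumW); rewrite addrK.
Qed.

Section Eigen.
Variables (K : fieldType) (g : lieAlgType K).

Lemma diagonalizable_stable (f : 'End(g)) (W : {vspace g}) (x : g) :
  diagonalizable_end f -> (forall w, w \in W -> f w \in W) -> x \in W ->
  exists2 s : seq g,
    (forall y, y \in s -> y \in W /\ exists c : K, f y = c *: y) &
    x = \sum_(y <- s) y.
Proof.
move=> [e be eig] stab xW.
have [c fc] : exists c : g -> K, forall v, v \in e -> f v = c v *: v.
  have /choice[c hc] : forall v, exists a : K, v \in e -> f v = a *: v.
    move=> v; have [ve|] := boolP (v \in e); last by exists 0.
    by have [a ha] := eig _ ve; exists a.
  by exists c.
have xe : x \in <<e>>%VS by rewrite (span_basis be) memvf.
have [k Dx _] := free_span (basis_free be) xe.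
rewrite (sum_by_value c) in Dx.
pose y (a : K) : g := \sum_(v <- e | c v == a) k v *: v.
have fy a : f (y a) = a *: y a.
  rewrite /y linear_sum scaler_sumr big_seq_cond [RHS]big_seq_cond.
  apply: eq_bigr => v /andP[ve /eqP <-].
  by rewrite linearZ /= fc // !scalerA mulrC.
exists (map y (undup (map c e))); last by rewrite big_map.
move=> _ /mapP[a aC ->]; split; last by exists a.
apply: (@stable_components _ _ W K unit (fun _ => f) (fun a _ => a)
          (undup (map c e)) y) => //.
- exact: undup_uniq.
- by rewrite -Dx.
Qed.

(** Each joint eigenspace W of the operators fs is stable under a further commuting
operator f, so the components of a vector of W under f stay in W. *)
Lemma joint_eigenvectors (fs : seq 'End(g)) (x : g) :
  (forall f h, f \in fs -> h \in fs -> forall y, f (h y) = h (f y)) ->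
  (forall f, f \in fs -> diagonalizable_end f) ->
  exists2 s : seq g,
    (forall y f, y \in s -> f \in fs -> exists c : K, f y = c *: y) &
    x = \sum_(y <- s) y.
Proof.
elim: fs x => [|f fs IH] x comm dg.
  by exists [:: x]; rewrite ?big_seq1.
have [|f' f's|s eigs ->] := IH x.
- by move=> f' h f's hs; apply: comm; rewrite inE ?f's ?hs orbT.
- by apply: dg; rewrite inE f's orbT.
elim: s eigs => [_|z s IHs eigs].
  by exists [::]; rewrite ?big_nil.
have [|s' eigs' E] := IHs.
  by move=> y f' ys; apply: eigs; rewrite inE ys orbT.
have [c fc] : exists c : 'End(g) -> K, forall f', f' \in fs -> f' z = c f' *: z.
  have /choice[c hc] : forall f', exists a : K, f' \in fs -> f' z = a *: z.
    move=> f'; have [f's|] := boolP (f' \in fs); last by exists 0.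
    by have [a ha] := eigs _ _ (mem_head _ _) f's; exists a.
  by exists c.
pose W := (\bigcap_(f' <- fs) lker (f' - c f' *: \1%VF))%VS.
have memW y : reflect (forall f', f' \in fs -> f' y = c f' *: y) (y \in W).
  rewrite /W; have -> : (y \in (\bigcap_(f' <- fs) lker (f' - c f' *: \1%VF))%VS) =
     all (fun f' : 'End(g) => f' y == c f' *: y) fs.
    elim: (fs) => [|f' l IHl]; first by rewrite big_nil memvf.
    rewrite big_cons memv_cap IHl memv_ker /=.
    by rewrite add_lfunE opp_lfunE scale_lfunE id_lfunE subr_eq0.
  apply: (iffP allP) => [h f' /h /eqP|h f' /h /eqP] //.
have [|w /memW wW||s1 eig1 E1] := @diagonalizable_stable f W z.
- by apply: dg; rewrite mem_head.
- apply/memW => f' f's; rewrite comm ?mem_head ?inE ?f's ?orbT //.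
  by rewrite wW // linearZ.
- exact/memW.
exists (s1 ++ s'); last by rewrite big_cons big_cat /= -E1 -E.
move=> y f'; rewrite mem_cat => /orP[ys|ys] f's; last exact: eigs'.
have [/memW yW yf] := eig1 _ ys.
by move: f's; rewrite inE => /orP[/eqP->//|/yW ?]; exists (c f').
Qed.

End Eigen.

(** * Traces *)

Section Trace.
Variables (K : fieldType) (V : vectType K).
Implicit Types (X : seq V) (f h : 'End(V)).

(** For a free family X whose span is stable under f, this is the trace of the
restriction of f to that span. *)
Definition trace X f : K := \sum_(i < size X) coord (in_tuple X) i (f X`_i).

Lemma trace_is_linear X : linear_for *%R (trace X).
Proof.
move=> a f h; rewrite /trace mulr_sumr -big_split; apply: eq_bigr => i _.
by rewrite add_lfunE scale_lfunE linearP.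
Qed.

HB.instance Definition _ X :=
  GRing.isLinear.Build K 'End(V) K *%R (trace X) (trace_is_linear X).

Lemma trace_comp X f h :
  (forall v, v \in X -> f v \in <<X>>%VS) ->
  (forall v, v \in X -> h v \in <<X>>%VS) ->
  trace X (f \o h)%VF = trace X (h \o f)%VF.
Proof.
suff E f' h' : (forall v, v \in X -> h' v \in <<X>>%VS) ->
    trace X (f' \o h')%VF =
    \sum_(i < size X) \sum_(j < size X)
       coord (in_tuple X) j (h' X`_i) * coord (in_tuple X) i (f' X`_j).
  move=> fX hX; rewrite (E f h hX) (E h f fX) exchange_big /=.
  by apply: eq_bigr => i _; apply: eq_bigr => j _; rewrite mulrC.
move=> hX; apply: eq_bigr => i _.
rewrite comp_lfunE {1}(@coord_span _ _ _ (in_tuple X) (h' X`_i)); last first.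
  by apply: hX; rewrite mem_nth.
by rewrite !linear_sum; apply: eq_bigr => j _; rewrite !linearZ.
Qed.

Lemma trace_diag X f (c : V -> K) :
  free X -> (forall v, v \in X -> f v = c v *: v) ->
  trace X f = \sum_(v <- X) c v.
Proof.
move=> frX fX; rewrite (big_nth 0) big_mkord; apply: eq_bigr => i _.
rewrite fX ?mem_nth // linearZ /=.
by rewrite (@coord_free _ _ _ (in_tuple X) i i frX) eqxx mulr1.
Qed.

End Trace.

(** * Weight bases *)

Section Bracket.
Variables (K : fieldType) (g : lieAlgType K).
Implicit Types x y z h : g.

Lemma lieNr x y : lie x (- y) = - lie x y.
Proof. exact: linearN. Qed.

Lemma lie_derivation h x y : lie h (lie x y) = lie (lie h x) y + lie x (lie h y).
Proof.
have := lie_jacobi h x y.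
rewrite (lieC y h) lieNr (lieC y (lie h x)) -addrA -opprD => /subr0_eq ->.
by rewrite addrC.
Qed.

Lemma ad_lie x y : ad (lie x y) = (ad x \o ad y)%VF - (ad y \o ad x)%VF.
Proof.
apply/lfunP => z; rewrite add_lfunE opp_lfunE !comp_lfunE !adE.
by rewrite [lie x (lie y z)]lie_derivation addrK.
Qed.

Lemma trace_ad_lie x y (X : seq g) :
  (forall v, v \in X -> lie x v \in <<X>>%VS) ->
  (forall v, v \in X -> lie y v \in <<X>>%VS) ->
  trace X (ad (lie x y)) = 0.
Proof.
move=> xX yX; rewrite ad_lie linearB /= trace_comp ?subrr // => v vX; rewrite adE.
  exact: xX.
exact: yX.
Qed.

Variable t : {vspace g}.

Lemma root_space_lie (al be : dual t) x y :
  x \in root_space al -> y \in root_space be -> lie x y \in root_space (al + be).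
Proof.
move=> /root_spaceP hx /root_spaceP hy; apply/root_spaceP => h.
by rewrite lie_derivation hx hy lieZl linearZ /= -scalerDl add_lfunE.
Qed.

Hypothesis ct : cartan t.

Lemma root_space0 : root_space (0 : dual t) = t.
Proof.
have [tt0 tmax _] := ct; apply/vspaceP => x; apply/idP/idP => [/root_spaceP h|xt].
  apply: tmax => k kt; have := h (vsproj t k).
  by rewrite vsprojK // zero_lfunE scale0r.
apply/root_spaceP => h; rewrite zero_lfunE scale0r; apply/eqP.
by rewrite -memv0; apply: tt0 => //; exact: subvsP.
Qed.

(** The weight is the functional that sends h to phi([h, x]), for phi a coordinate
with phi(x) = 1; this makes its linearity automatic. *)
Lemma joint_eigenvector_weight x :
  (forall h : subvs_of t, h \in vbasis {: subvs_of t} ->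
     exists c : K, lie (vsval h) x = c *: x) ->
  exists al : dual t, x \in root_space al.
Proof.
move=> eig; have [->|nz] := eqVneq x 0; first by exists 0; rewrite mem0v.
have {}eig (h : subvs_of t) : exists c : K, lie (vsval h) x = c *: x.
  rewrite (coord_vbasis (memvf h)).
  apply: (big_ind (fun h : subvs_of t => exists c : K, lie (vsval h) x = c *: x)).
  - by exists 0; rewrite linear0 scale0r lie0l.
  - move=> p q [c Hc] [d Hd]; exists (c + d).
    by rewrite linearD /= lieDl Hc Hd scalerDl.
  move=> i _; have [|c hc] := eig (vbasis {: subvs_of t})`_i.
    by rewrite mem_nth ?size_tuple.
  exists (coord (vbasis {: subvs_of t}) i h * c).
  by rewrite linearZ /= lieZl hc scalerA.
pose b := vbasis {: g}.
have [i nzi] : exists i, coord b i x != 0.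
  apply/existsP; apply: contraNT nz; rewrite negb_exists => /forallP h0.
  rewrite (coord_vbasis (memvf x)) big1 // => i _.
  by have := h0 i; rewrite negbK => /eqP ->; rewrite scale0r.
pose phi : 'Hom(g, K^o) := linfun (coord b i : g -> K^o).
pose al : dual t :=
  (coord b i x)^-1 *: ((phi \o - ad x) \o linfun (@vsval _ _ t))%VF.
exists al; apply/root_spaceP => h; have [c hc] := eig h.
rewrite scale_lfunE !comp_lfunE opp_lfunE adE !lfunE /= -lieC hc linearZ /=.
by congr (_ *: _); rewrite [RHS]mulrCA mulVf // mulr1.
Qed.

Lemma weight_basis : exists (e : seq g) (wt : g -> dual t),
  basis_of fullv e /\ forall v, v \in e -> v \in root_space (wt v).
Proof.
have [tt0 _ tdg] := ct.
pose fs := [seq ad (vsval h) | h : subvs_of t <- vbasis {: subvs_of t}].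
have J x : exists s : seq g,
    (forall y, y \in s -> exists al : dual t, y \in root_space al) /\
    x = \sum_(y <- s) y.
  have [||s eigs ->] := @joint_eigenvectors _ _ fs x.
  - move=> _ _ /mapP[h _ ->] /mapP[k _ ->] y; rewrite !adE.
    rewrite [LHS]lie_derivation; have -> : lie (vsval h) (vsval k) = 0.
      by apply/eqP; rewrite -memv0; apply: tt0; exact: subvsP.
    by rewrite lie0l add0r.
  - by move=> _ /mapP[h _ ->]; apply: tdg; exact: subvsP.
  exists s; split=> // y ys; apply: joint_eigenvector_weight => h hb.
  by rewrite -adE; apply: eigs => //; apply: map_f.
have /choice[s hs] := J.
pose s0 := flatten [seq s x | x <- vbasis {: g}].
have [e [sub fr E]] := span_free_subseq s0.
have se : (<<e>> = fullv)%VS.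
  rewrite E; apply/eqP; rewrite eqEsubv subvf.
  rewrite -[X in (X <= _)%VS](span_basis (vbasisP _)).
  apply/span_subvP => x xb; rewrite (proj2 (hs x)) big_seq; apply: memv_suml.
  move=> y ys; apply: memv_span; apply/flatten_mapP; by exists x.
have /choice[wt hwt] : forall v, exists al : dual t, v \in e -> v \in root_space al.
  move=> v; have [ve|] := boolP (v \in e); last by exists 0.
  have /flatten_mapP[x _ vx] := sub _ ve.
  by have [al hal] := proj1 (hs x) _ vx; exists al.
by exists e, wt; split; rewrite /basis_of ?se ?eqxx.
Qed.

End Bracket.

(** * Linear functionals on the Cartan subalgebra *)

Section Functionals.
Variables (K : fieldType) (g : lieAlgType K) (t : {vspace g}).
Implicit Types (al be : dual t) (h : subvs_of t) (S : seq (dual t)).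

Lemma dim_dual : \dim {: dual t} = \dim t.
Proof. by rewrite dimvf /= /dim /= muln1. Qed.

Lemma dual_neqP al be : al != be -> exists h, (al h : K) != be h.
Proof.
move=> ne; apply: contrapT => nex; move: ne; apply/negP; rewrite negbK.
apply/eqP/lfunP => h; apply/eqP; apply: contrapT => ne; apply: nex.
by exists h; apply/negP.
Qed.

Lemma span_vanish S h :
  (forall be, be \in S -> (be h : K) = 0) ->
  forall al, al \in <<S>>%VS -> (al h : K) = 0.
Proof.
move=> S0 al /(@coord_span _ _ _ (in_tuple S)) ->.
rewrite sum_lfunE big1 // => i _.
by rewrite scale_lfunE S0 ?scaler0 // mem_nth.
Qed.

Lemma span_separates S h : (<<S>> = fullv)%VS ->
  (forall al, al \in S -> (al h : K) = 0) -> h = 0.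
Proof.
move=> full S0; rewrite (coord_vbasis (memvf h)) big1 // => i _.
pose phi : dual t := linfun (coord (vbasis {: subvs_of t}) i : subvs_of t -> K^o).
have := @span_vanish S h S0 phi; rewrite full memvf => /(_ isT).
by rewrite lfunE /= => ->; rewrite scale0r.
Qed.

(** Each functional lowers the dimension of the common kernel by at most one, and
fewer than dim t of them span the span of S. *)
Lemma common_zero S : (<<S>> != fullv)%VS ->
  exists2 h, h != 0 & forall al, al \in S -> (al h : K) = 0.
Proof.
have [S' [sub fr E]] := span_free_subseq S; rewrite -E => nf.
have szS : (size S' < \dim t)%N.
  rewrite -dim_dual ltnNge; apply: contra nf => le.
  by apply/eqP/span_basis; rewrite basisEfree fr subvf.
have [U [dU zU]] : exists U : {vspace subvs_of t},
    (\dim t <= \dim U + size S')%N /\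
    forall h al, h \in U -> al \in S' -> (al h : K) = 0.
  elim: (S') => [|al S1 [U [dU zU]]].
    by exists fullv; rewrite addn0 dimvf.
  exists (U :&: lker al)%VS; split.
    have d1 : (\dim (al @: U) <= 1)%N.
      by rewrite (leq_trans (dimvS (subvf _))) // dimvf.
    apply: leq_trans dU _; rewrite -(limg_ker_dim al U) -addnA leq_add2l.
    by rewrite addnC [leqRHS]/= -addn1 leq_add2l.
  move=> h be; rewrite memv_cap memv_ker => /andP[hU /eqP h0].
  by rewrite inE => /orP[/eqP->//|]; apply: zU.
have Unz : U != 0%VS.
  apply: contraTneq szS => U0; rewrite -leqNgt.
  by apply: leq_trans dU _; rewrite U0 dimv0.
exists (vpick U); first by rewrite vpick0.
move=> al /memv_span; rewrite -E; apply: span_vanish => be beS.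
by apply: zU => //; exact: memv_pick.
Qed.

(** The differences of the first functional p with the others cannot span the dual,
so they have a nonzero common zero h.  All members of S agree at h, their value
is nonzero since S separates points, and h is rescaled. *)
Lemma basis_unit_point S : basis_of fullv S ->
  exists h, forall al, al \in S -> (al h : K) = 1.
Proof.
move=> bS; have full := span_basis bS.
have szS : size S = \dim t by rewrite -dim_dual -(size_basis (X := in_tuple S) bS).
case: S => [|p S] in bS full szS *; first by exists 0.
have [|h nz h0] := @common_zero [seq al - p | al <- S].
  apply/negP => /eqP E; have := dim_span [seq al - p | al <- S].
  by rewrite E dim_dual -szS size_map ltnn.
have hp al : al \in p :: S -> (al h : K) = p h.
  rewrite inE => /orP[/eqP->//|alS]; apply/eqP; rewrite -subr_eq0.
  have := h0 _ (map_f (fun al => al - p) alS).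
  by rewrite add_lfunE opp_lfunE => ->.
have pnz : (p h : K) != 0.
  apply: contraNneq nz => ph; apply/eqP; apply: (span_separates full) => al alS.
  by rewrite hp.
exists ((p h : K)^-1 *: h) => al alS; rewrite linearZ /= hp //.
exact: mulVf.
Qed.

End Functionals.

(** * Weight components *)

Section WeightBasis.
Variables (K : numFieldType) (g : lieAlgType K) (t : {vspace g}).
Variables (e : seq g) (wt : g -> dual t).
Hypothesis be : basis_of fullv e.
Hypothesis ewt : forall v, v \in e -> v \in root_space (wt v).
Implicit Types (x y z : g) (al : dual t) (W : {vspace g}) (P : pred g).

Lemma root_space_stable al (h : subvs_of t) x :
  x \in root_space al -> lie (vsval h) x \in root_space al.
Proof. by move=> xr; move/root_spaceP: (xr) => ->; exact: memvZ. Qed.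

Lemma weight_inj al al' x :
  x != 0 -> x \in root_space al -> x \in root_space al' -> al = al'.
Proof.
move=> nz /root_spaceP h1 /root_spaceP h2; apply/lfunP => h; apply/eqP.
rewrite -subr_eq0; have : ((al h : K) - al' h) *: x == 0.
  by rewrite scalerBl -h1 -h2 subrr.
by rewrite scaler_eq0 (negPf nz) orbF.
Qed.

Lemma weight_components W w :
  (forall (h : subvs_of t) x, x \in W -> lie (vsval h) x \in W) -> w \in W ->
  exists (C : seq (dual t)) (y : dual t -> g),
    [/\ w = \sum_(al <- C) y al,
        forall al, y al \in <<[seq v <- e | wt v == al]>>%VS,
        forall al, y al \in root_space al &
        forall al, al \in C -> y al \in W].
Proof.
move=> stab wW.
have we : w \in <<e>>%VS by rewrite (span_basis be) memvf.
have [k Dw _] := free_span (basis_free be) we.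
rewrite (sum_by_value wt) in Dw.
pose y al : g := \sum_(v <- e | wt v == al) k v *: v.
have yr al : y al \in root_space al.
  rewrite /y big_seq_cond; apply: memv_suml => v /andP[ve /eqP <-].
  by apply: memvZ; exact: ewt.
exists (undup (map wt e)), y; split=> //.
  move=> al; rewrite /y big_seq_cond; apply: memv_suml => v /andP[ve wv].
  by apply: memvZ; apply: memv_span; rewrite mem_filter wv.
apply: (@stable_components _ _ W _ (subvs_of t) (fun h => ad (vsval h))
          (fun al h => al h)); rewrite ?undup_uniq //.
- by move=> h x; rewrite adE; apply: stab.
- exact: dual_neqP.
- by move=> al h _; rewrite adE; move/root_spaceP: (yr al).
- by rewrite -Dw.
Qed.

Lemma root_space_span al x :
  x \in root_space al -> x \in <<[seq v <- e | wt v == al]>>%VS.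
Proof.
move=> xr; have [|C [y [-> ys yr yW]]] := @weight_components (root_space al) x _ xr.
  by move=> h z; exact: root_space_stable.
rewrite big_seq; apply: memv_suml => al' aC.
have [->|nz] := eqVneq (y al') 0; first exact: mem0v.
by rewrite (weight_inj nz (yW _ aC) (yr al')).
Qed.

Lemma exists_weight al :
  (root_space al != 0)%VS -> exists2 v, v \in e & wt v = al.
Proof.
move=> nz; have := root_space_span (memv_pick (root_space al)).
case E : [seq v <- e | wt v == al] => [|v s].
  by rewrite span_nil memv0 vpick0 (negPf nz).
have : v \in [seq v <- e | wt v == al] by rewrite E mem_head.
by rewrite mem_filter => /andP[/eqP <- ve]; exists v.
Qed.

Lemma lie_mem_span_filter P al x v :
  x \in root_space al -> v \in e ->
  (forall u, u \in e -> wt u = al + wt v -> P u) ->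
  lie x v \in <<[seq u <- e | P u]>>%VS.
Proof.
move=> xr ve sub; have /root_space_span := root_space_lie xr (ewt ve).
apply: subvP; apply: sub_span => u; rewrite !mem_filter => /andP[/eqP Eu ue].
by rewrite sub.
Qed.

(** The sum is the trace of ad [x, y] = [ad x, ad y] on the span of the basis vectors
satisfying P. *)
Lemma weight_sum0 P x y (h : subvs_of t) :
  lie x y = vsval h ->
  (forall v, v \in e -> P v ->
     lie x v \in <<[seq u <- e | P u]>>%VS /\
     lie y v \in <<[seq u <- e | P u]>>%VS) ->
  \sum_(v <- e | P v) (wt v h : K) = 0.
Proof.
move=> Eh stab; rewrite -big_filter.
rewrite -(@trace_diag _ _ _ (ad (vsval h)) (fun v => wt v h)).
- rewrite -Eh; apply: trace_ad_lie => v; rewrite mem_filter => /andP[Pv ve].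
    exact: (stab v ve Pv).1.
  exact: (stab v ve Pv).2.
- by apply: filter_free; exact: basis_free be.
- move=> v; rewrite mem_filter => /andP[Pv ve]; rewrite adE.
  by move/root_spaceP: (ewt ve).
Qed.

(** * The Killing form *)

Definition killing (z x : g) : K := trace e (ad x \o ad z)%VF.

Lemma killing_is_linear z : linear_for *%R (killing z).
Proof.
move=> a x y; rewrite /killing -linearP; congr (trace e _).
apply/lfunP => v; rewrite add_lfunE scale_lfunE !comp_lfunE !adE.
by rewrite lieDl lieZl.
Qed.

HB.instance Definition _ z :=
  GRing.isLinear.Build K g K^o *%R (killing z) (killing_is_linear z).

Lemma trace_full_comp (f h : 'End(g)) :
  trace e (f \o h)%VF = trace e (h \o f)%VF.
Proof. by apply: trace_comp => v _; rewrite (span_basis be) memvf. Qed.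

Lemma killingC x y : killing x y = killing y x.
Proof. exact: trace_full_comp. Qed.

Lemma killing_lie x y z : killing z (lie x y) = killing (lie y z) x.
Proof.
rewrite /killing !ad_lie.
have -> : (((ad x \o ad y)%VF - (ad y \o ad x)%VF) \o ad z)%VF =
   (ad x \o (ad y \o ad z))%VF - (ad y \o (ad x \o ad z))%VF.
  apply/lfunP => v.
  by rewrite add_lfunE opp_lfunE !comp_lfunE add_lfunE opp_lfunE !comp_lfunE.
have -> : (ad x \o ((ad y \o ad z)%VF - (ad z \o ad y)%VF))%VF =
   (ad x \o (ad y \o ad z))%VF - ((ad x \o ad z) \o ad y)%VF.
  apply/lfunP => v; rewrite add_lfunE opp_lfunE !comp_lfunE.
  by rewrite add_lfunE opp_lfunE !comp_lfunE linearB.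
by rewrite !linearB /= (trace_full_comp (ad y)).
Qed.


Hypothesis ct : cartan t.
Hypothesis sg : simple_lie g.
Variable Pi : (\dim t).-tuple (dual t).
Hypothesis sPi : simple_roots Pi.

Lemma weight_root v : v \in e -> wt v != 0 -> is_root (wt v).
Proof.
move=> ve nz; split=> //; apply: contraTneq (ewt ve) => ->.
by rewrite memv0 (basis_not0 be).
Qed.

Lemma nat_comb_at_unit_point (h0 : subvs_of t) al :
  (forall p, p \in Pi -> (p h0 : K) = 1) -> al != 0 -> nat_comb Pi al ->
  exists2 n, (0 < n)%N & (al h0 : K) = n%:R.
Proof.
move=> h01 nz [c Dal]; exists (\sum_i c i)%N.
  rewrite lt0n sum_nat_eq0; apply: contra nz => /forallP c0.
  by rewrite Dal big1 // => i _; have /eqP -> := c0 i; rewrite mulr0n.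
rewrite Dal sum_lfunE natr_sum; apply: eq_bigr => i _.
by rewrite -scaler_nat scale_lfunE h01 ?mem_tnth // scaler_nat.
Qed.

(** At the point of t where all simple roots are 1 each root takes a nonzero integer
value, so the trace of the square of its adjoint is a sum of squares of integers,
not all 0 because g is not commutative. *)
Lemma killing_neq0 : exists h, killing h h != 0.
Proof.
have [bPi _ pos] := sPi; have [h0 h01] := basis_unit_point bPi.
have sq v : v \in e -> wt v != 0 -> 0 < (wt v h0 : K) ^+ 2.
  move=> ve nz; case: (pos _ (weight_root ve nz)) => nc.
    have [n n0 ->] := nat_comb_at_unit_point h01 nz nc.
    by rewrite -natrX ltr0n expn_gt0 n0.
  have [|n n0] := nat_comb_at_unit_point h01 _ nc; first by rewrite oppr_eq0.
  rewrite opp_lfunE => E; rewrite -sqrrN E.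
  by rewrite -natrX ltr0n expn_gt0 n0.
have sq0 v : v \in e -> 0 <= (wt v h0 : K) ^+ 2.
  move=> ve; have [->|/(sq _ ve)/ltW//] := eqVneq (wt v) 0.
  by rewrite zero_lfunE expr0n.
have [v ve nz] : exists2 v, v \in e & wt v != 0.
  apply: contrapT => nex; have [[x [y /negP nab]] _] := sg.
  have et : (fullv <= t)%VS.
    rewrite -(span_basis be); apply/span_subvP => v ve.
    have w0 : wt v = 0.
      by apply/eqP; apply: contrapT => /negP nz; apply: nex; exists v.
    by rewrite -(root_space0 ct) -w0 ewt.
  apply: nab; have [tt0 _ _] := ct; rewrite -memv0.
  by apply: tt0; apply: (subvP et); rewrite memvf.
exists (vsval h0).
rewrite /killing (@trace_diag _ _ _ _ (fun v => (wt v h0 : K) ^+ 2)).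
- apply: lt0r_neq0; rewrite (bigD1_seq v) ?(free_uniq (basis_free be)) //=.
  apply: ltr_wpDr; last exact: sq.
  by rewrite big_seq_cond; apply: sumr_ge0 => u /andP[ue _]; exact: sq0.
- exact: basis_free be.
- move=> u ue; rewrite comp_lfunE !adE; move/root_spaceP: (ewt ue) => E.
  by rewrite !E linearZ /= E scalerA.
Qed.

(** By invariance the radical is an ideal; it is not g by [killing_neq0]. *)
Lemma killing_nondegenerate x : x != 0 -> exists z, killing z x != 0.
Proof.
pose rad : {vspace g} :=
  (\bigcap_(z <- vbasis {: g}) lker (linfun (killing z : g -> K^o)))%VS.
have radP w : w \in rad <-> forall z, killing z w = 0.
  have -> : (w \in rad) = all (fun z => killing z w == 0) (vbasis {: g}).
    rewrite /rad; elim: (tval _) => [|z s IH]; first by rewrite big_nil memvf.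
    by rewrite big_cons memv_cap IH memv_ker lfunE.
  split=> [/allP rw z|rw]; last by apply/allP => z _; rewrite rw.
  rewrite killingC (coord_vbasis (memvf z)) linear_sum big1 // => i _.
  rewrite linearZ /= killingC.
  have ib : (vbasis {: g})`_i \in vbasis {: g} by rewrite mem_nth ?size_tuple.
  by rewrite (eqP (rw _ ib)) mulr0.
have [_ /(_ rad)[]] := sg.
- move=> a b _ /radP br; apply/radP => z.
  by rewrite lieC linearN /= killing_lie br oppr0.
- move=> r0 nz; apply: contrapT => nex; move: nz; rewrite -memv0 -r0.
  move=> /negP; apply; apply/radP => z; apply/eqP; apply: contrapT => /negP ne.
  by apply: nex; exists z.
move=> r1 _; have [h /negP[]] := killing_neq0.
have : h \in rad by rewrite r1 memvf.
by move=> /radP ->.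
Qed.

(** Some y in e has B(y, x) <> 0 by nondegeneracy.  The identity
B([h, x], y) = - B(x, [h, y]) forces its weight to be - al, and
B([x, y], h) = al(h) B(x, y) shows that [x, y] is nonzero. *)
Lemma root_pairing al x : al != 0 -> x \in root_space al -> x != 0 ->
  exists y, [/\ y \in e, wt y = - al & lie x y != 0].
Proof.
move=> anz xr xnz; have [z kz] := killing_nondegenerate xnz.
have [y ye ky] : exists2 y, y \in e & killing y x != 0.
  apply: contrapT => nex; move/negP: kz; apply.
  have ze : z \in <<in_tuple e>>%VS by rewrite (span_basis be) memvf.
  rewrite killingC (coord_span ze) linear_sum big1 // => i _.
  rewrite linearZ /= killingC; suff -> : killing e`_i x = 0 by rewrite mulr0.
  apply/eqP; apply: contrapT => /negP ne; apply: nex.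
  by exists e`_i => //; rewrite mem_nth.
have kxy : killing x y != 0 by rewrite killingC.
have /root_spaceP xw := xr; have /root_spaceP yw := ewt ye.
have wy : wt y = - al.
  apply/lfunP => h; rewrite opp_lfunE; apply/eqP; rewrite -subr_eq0 opprK.
  have := killing_lie y (vsval h) x.
  rewrite lieC linearN /= yw linearZ /=.
  rewrite killingC [RHS]killingC xw linearZ /= killingC.
  move/eqP; rewrite eq_sym -subr_eq0 opprK -mulrDl addrC mulf_eq0.
  by rewrite (negPf kxy) orbF.
exists y; split=> //; have [h ah] := dual_neqP anz.
apply: contraNneq ky => xy0; have := killing_lie (vsval h) x y.
rewrite xy0 [RHS]killingC linear0 xw linearZ /=.
rewrite zero_lfunE in ah.
by move/eqP; rewrite mulf_eq0 (negPf ah).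
Qed.

(** * Root strings *)

(** If al vanishes at h = [x, y], then all weights in the al-string through a root bt
agree with bt at h.  The sum of the weights over the string is 0 at h, so
bt(h) = 0 for every simple root bt, and h = 0. *)
Lemma root_neq0_at_bracket al x y (h : subvs_of t) :
  al != 0 -> x \in root_space al -> y \in root_space (- al) ->
  lie x y = vsval h -> lie x y != 0 -> (al h : K) != 0.
Proof.
move=> anz xr yr Eh; apply: contraNneq => ah0.
have [bPi rPi _] := sPi.
suff h0 : h = 0 by rewrite Eh h0 linear0.
apply: (span_separates (span_basis bPi)) => bt /rPi[bnz rb].
pose P v := `[< exists m : int, wt v = bt + al *~ m >].
have PE v : P v -> (wt v h : K) = bt h.
  move=> /asboolP[m ->].
  have -> : al *~ m = (m%:~R : K) *: al by rewrite scaler_int.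
  by rewrite add_lfunE scale_lfunE ah0 scaler0 addr0.
have [v0 v0e wv0] := exists_weight rb.
have closed u v m : P v -> wt u = al *~ m + wt v -> P u.
  move=> /asboolP[k Ev] Eu; apply/asboolP; exists (m + k).
  by rewrite Eu Ev mulrzDr addrCA.
have S0 : \sum_(v <- e | P v) (wt v h : K) = 0.
  apply: (weight_sum0 Eh) => v ve Pv; split.
    by apply: (lie_mem_span_filter xr ve) => u _ Eu; apply: (closed u v 1 Pv).
  apply: (lie_mem_span_filter yr ve) => u _ Eu.
  by apply: (closed u v (- 1) Pv); rewrite mulrNz mulr1z.
move/eqP: S0; rewrite (eq_bigr (fun=> (bt h : K))) // big_const_seq iter_addr_0.
rewrite mulrn_eq0 => /orP[|/eqP//].
rewrite eqn0Ngt -has_count => /hasP[]; exists v0 => //.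
by apply/asboolP; exists 0; rewrite mulr0z addr0.
Qed.

(** The span of y, of t and of the spaces g_(k al) with k > 0 is stable under ad x and
ad y.  Dividing the trace of ad [x, y] on it by al([x, y]) gives
-1 + sum of k dim g_(k al) = 0, so that two independent vectors of weight al
cannot exist. *)
Lemma root_space_dim1 al x :
  al != 0 -> x \in root_space al -> x != 0 -> root_space al = <[x]>%VS.
Proof.
move=> anz xr xnz; have [y [ye wy xy]] := root_pairing anz xr xnz.
have yr : y \in root_space (- al) by rewrite -wy ewt.
have xyt : lie x y \in t.
  by rewrite -(root_space0 ct) -(subrr al); exact: root_space_lie.
pose h := vsproj t (lie x y).
have Eh : lie x y = vsval h by rewrite vsprojK.
have ah := root_neq0_at_bracket anz xr yr Eh xy.
pose P v := (v == y) || `[< exists k : nat, wt v = al *+ k >].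
have anat k : (al *+ k == 0) = (k == 0%N).
  by rewrite -scaler_nat scaler_eq0 (negPf anz) orbF pnatr_eq0.
have Pnat u k : wt u = al *+ k -> P u.
  by move=> E; apply/orP; right; apply/asboolP; exists k.
have zeroP u : wt u = 0 -> P u by move=> E; apply: (Pnat u 0%N).
have S0 : \sum_(v <- e | P v) (wt v h : K) = 0.
  apply: (weight_sum0 Eh) => v ve /orP[/eqP->|/asboolP[k Ev]]; split.
  - apply: (lie_mem_span_filter xr ye) => u _; rewrite wy subrr.
    exact: zeroP.
  - by rewrite liexx mem0v.
  - apply: (lie_mem_span_filter xr ve) => u _; rewrite Ev -mulrS.
    exact: Pnat.
  case: k Ev => [|k] Ev.
    rewrite mulr0n in Ev; have vt : v \in t by rewrite -(root_space0 ct) -Ev ewt.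
    have /root_spaceP yw := yr; have := yw (vsproj t v); rewrite vsprojK //.
    move=> vy; rewrite lieC vy -scaleNr; apply: memvZ; apply: memv_span.
    by rewrite mem_filter ye /P eqxx.
  apply: (lie_mem_span_filter yr ve) => u _; rewrite Ev mulrS addKr.
  exact: Pnat.
have uniq_wt u1 u2 : u1 \in e -> u2 \in e -> wt u1 = al -> wt u2 = al -> u1 = u2.
  move=> e1 e2 w1 w2; apply/eqP; apply: contrapT => /negP ne.
  have ya u : wt u = al -> y != u.
    move=> wu; apply: contraTneq isT => yu.
    by have := anat 2; rewrite mulr2n -{1}wu -yu wy addNr eqxx.
  have ue := free_uniq (basis_free be).
  (* The other terms are nonnegative integers, and these three add up to 1. *)
  have : \sum_(v <- [:: y; u1; u2]) (wt v h : K) / al h <= 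
      \sum_(v <- e | P v) (wt v h : K) / al h.
    have us : uniq [:: y; u1; u2].
      by rewrite /= !inE negb_or !ya ?ne.
    have -> : \sum_(v <- [:: y; u1; u2]) (wt v h : K) / al h =
        \sum_(v <- e | v \in [:: y; u1; u2]) (wt v h : K) / al h.
      rewrite -[RHS]big_filter; apply: perm_big; apply: uniq_perm => //.
        exact: filter_uniq.
      move=> v; rewrite mem_filter andb_idr //.
      by rewrite !inE => /or3P[] /eqP->.
    rewrite big_mkcond [leRHS]big_mkcond /= big_seq [leRHS]big_seq.
    apply: ler_sum => v ve; rewrite !inE.
    have [-> /=|vy /=] := eqVneq v y; first by rewrite /P eqxx.
    case: ifP => [/orP[]/eqP Dv|_].
    - by rewrite (Pnat v 1%N) // Dv.
    - by rewrite (Pnat v 1%N) // Dv.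
    case: ifP => // /orP[|/asboolP[k ->]]; first by rewrite (negPf vy).
    by rewrite -scaler_nat scale_lfunE -[_ *: _]/(_ * _) mulfK // ler0n.
  rewrite !big_cons big_nil -mulr_suml S0 mul0r wy w1 w2 opp_lfunE.
  by rewrite mulNr divff // addr0 addKr ler10.
have [u ue wu] : exists2 u, u \in e & wt u = al.
  by apply: exists_weight; apply: contraTneq xr => ->; rewrite memv0.
have sub : (root_space al <= <[u]>)%VS.
  apply/subvP => z /root_space_span; apply: subvP.
  apply/span_subvP => v; rewrite mem_filter => /andP[/eqP wv ve].
  by rewrite (uniq_wt v u) // memv_line.
apply/eqP; rewrite eqEsubv -[(_ <= root_space al)%VS]memvE xr andbT.
apply: (subv_trans sub); have /vlineP[c Dx] := subvP sub _ xr.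
have cnz : c != 0 by apply: contraNneq xnz => c0; rewrite Dx c0 scale0r.
by rewrite -memvE Dx; apply/vlineP; exists c^-1; rewrite scalerA mulVf ?scale1r.
Qed.


(** * Centralisers of abelian ideals *)

Variables (Dp : seq (dual t)) (a : {vspace g}).
Hypothesis DpP : forall al, al \in Dp <-> is_root al /\ nat_comb Pi al.
Hypothesis aid : abelian_ideal Dp a.

Lemma span_filterC P x :
  x \in <<[seq v <- e | P v]>>%VS -> x \in <<[seq v <- e | ~~ P v]>>%VS -> x = 0.
Proof.
have := basis_free be; rewrite -(perm_free (permEl (perm_filterC P e))) cat_free.
case/and3P => _ _; rewrite directv_addE => /andP[_ /andP[_ /eqP cap0]] xP xC.
by apply/eqP; rewrite -memv0 -cap0 memv_cap xP.
Qed.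

Lemma root_space_nilradical al : al \in Dp -> (root_space al <= nilradical Dp)%VS.
Proof. by move=> aD; rewrite /nilradical (big_rem _ aD) addvSl. Qed.

Lemma nilradical_weight al x :
  x \in nilradical Dp -> x \in root_space al -> x != 0 -> al \in Dp.
Proof.
move=> xn xr; apply: contraR => aD; apply/eqP.
apply: (@span_filterC (fun v => wt v \in Dp)).
  apply: subvP xn; rewrite /nilradical big_seq.
  elim/big_ind: _ => [|U V sU sV|bt bD]; first exact: sub0v.
    by rewrite subv_add sU.
  apply/subvP => z /root_space_span; apply: subvP; apply: sub_span => v.
  by rewrite !mem_filter => /andP[/eqP-> ->]; rewrite bD.
apply: subvP (root_space_span xr); apply: sub_span => v.
by rewrite !mem_filter => /andP[/eqP-> ->]; rewrite aD.
Qed.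

Lemma cartan_borel : (t <= borel Dp)%VS.
Proof. exact: addvSr. Qed.

Lemma cartan_nilradical0 x : x \in t -> x \in nilradical Dp -> x = 0.
Proof.
move=> xt xn; have x0 : x \in root_space (0 : dual t) by rewrite (root_space0 ct).
apply/eqP; apply: contrapT => /negP nz.
by have /DpP[[]] := nilradical_weight xn x0 nz; rewrite eqxx.
Qed.

Lemma centraliser_stable b x :
  b \in borel Dp -> x \in centraliser a -> lie b x \in centraliser a.
Proof.
have [_ ia _] := aid; move=> bb /centraliserP xa; apply/centraliserP => y ya.
have := lie_derivation b x y.
by rewrite xa // linear0 (xa _ (ia _ _ bb ya)) addr0.
Qed.

(** A root of a vanishes at an element of t that centralises a, and the roots of a
separate the points of t. *)
Lemma centraliser_cartan0 x :
  full_rank Dp a -> x \in centraliser a -> x \in t -> x = 0.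
Proof.
move=> [s [ss szs frs]] /centraliserP xa xt.
have full : (<<s>> = fullv)%VS.
  by apply: span_basis; rewrite basisEfree frs subvf dim_dual szs /=.
rewrite -(vsprojK xt); suff -> : vsproj t x = 0 by rewrite linear0.
apply: (span_separates full) => al /ss; rewrite mem_filter => /andP[ra /DpP[[_ nz] _]].
have vr := memv_pick (root_space al); have /root_spaceP av := vr.
have /esym/eqP := av (vsproj t x).
rewrite vsprojK // xa ?(subvP ra) // scaler_eq0 vpick0 (negPf nz) orbF.
by move/eqP.
Qed.

(** A component of z of weight - gamma, with gamma positive, brackets with some
element of g_gamma to a nonzero element of z in t. *)
Lemma centraliser_nilradical :
  full_rank Dp a -> (centraliser a <= nilradical Dp)%VS.
Proof.
move=> fr; apply/subvP => w wz.
have [|C [y [-> _ yr yz]]] := @weight_components (centraliser a) w _ wz.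
  move=> h z; apply: centraliser_stable.
  by apply: (subvP cartan_borel); exact: subvsP.
rewrite big_seq; apply: memv_suml => al /yz {}yz.
have [->|ynz] := eqVneq (y al) 0; first exact: mem0v.
have [a0|anz] := eqVneq al 0.
  case/eqP: ynz; apply: centraliser_cartan0 => //.
  by have := yr al; rewrite {2}a0 (root_space0 ct).
have ra : is_root al.
  by split=> //; apply: contraTneq (yr al) => ->; rewrite memv0.
have [_ _ pos] := sPi; case: (pos _ ra) => nc.
  by apply: (subvP (root_space_nilradical _)) (yr al); apply/DpP.
have [u [ue wu yu]] := root_pairing anz (yr al) ynz.
have ur : u \in root_space (- al) by rewrite -wu ewt.
have naD : - al \in Dp.
  by apply/DpP; split=> //; rewrite -wu; apply: weight_root; rewrite ?wu ?oppr_eq0.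
case/eqP: yu; apply: centraliser_cartan0 => //.
  rewrite lieC memvN; apply: centraliser_stable => //.
  by apply: (subvP (addvSl _ _)); apply: (subvP (root_space_nilradical naD)).
by have := root_space_lie (yr al) ur; rewrite subrr (root_space0 ct).
Qed.

(** A common zero h of the roots of a kills every weight component of an element of a:
such a component lies in a, spans its root space, and so its weight is a root of a.
Hence h is in z but not in u. *)
Lemma centraliser_full_rank :
  (centraliser a <= nilradical Dp)%VS -> full_rank Dp a.
Proof.
have [an ia aa] := aid; move=> zn.
have [full|/common_zero[h nz h0]] := eqVneq <<ideal_roots Dp a>>%VS fullv.
  have [s [ss fr E]] := span_free_subseq (ideal_roots Dp a).
  exists s; split=> //; rewrite -dim_dual -full -E.
  exact/esym/eqP.
case/eqP: nz; apply: subvs_inj; rewrite linear0.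
apply: cartan_nilradical0; first exact: subvsP.
apply: (subvP zn); apply/centraliserP => x xa.
have [|C [y [-> _ yr ya]]] := @weight_components a x _ xa.
  move=> k z za; apply: ia => //.
  by apply: (subvP cartan_borel); exact: subvsP.
rewrite big_seq linear_sum big1 // => al /ya {}ya.
have [->|ynz] := eqVneq (y al) 0; first by rewrite linear0.
have aD := nilradical_weight (subvP an _ ya) (yr al) ynz.
have /DpP[[anz _] _] := aD.
have /root_spaceP hy := yr al; rewrite /= hy h0 ?scale0r //.
by rewrite mem_filter aD andbT (root_space_dim1 anz (yr al) ynz) -memvE.
Qed.

End WeightBasis.

Theorem lemma4p1 (R : realType) (g : lieAlgType R[i]) (t : {vspace g})
    (Dp : seq (dual t)) (a : {vspace g}) :
  simple_lie g -> cartan t -> positive_roots Dp -> abelian_ideal Dp a ->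
  (centraliser a <= nilradical Dp)%VS <-> full_rank Dp a.
Proof.
move=> sg ct [_ [Pi sPi DpP]] aid; have [e [wt [be ewt]]] := weight_basis ct.
split.
  exact: (centraliser_full_rank be ewt ct sg sPi DpP aid).
exact: (centraliser_nilradical be ewt ct sg sPi DpP aid).
Qed.
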